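(* Let $\theta\in[0,1]$, $\epsilon>0$, $C_0>0$, and let $0=t_0<t_1<\cdots<t_N=T$ be an arbitrary time grid. Let $u_0^h,u_1^h\in X_s^h$ and $r_0^h,r_1^h\in\mathbb{R}$ be given and let $u_{n+1}^h\in X_s^h$, $r_{n+1}^h\in\mathbb{R}$ ($n=1,\dots,N-1$) be generated by the variable time-stepping DLN-SAV algorithm: for all $v^h\in X_s^h$, $$\Big(\frac{u_{n,\alpha}^{h}}{\widehat{k}_{n}}, v^{h}\Big)+\epsilon^{2}\big(\nabla u_{n,\beta}^{h},\nabla v^{h}\big)+\frac{r_{n,\beta}^{h}}{\sqrt{E(u_{n,\ast}^{h})+C_{0}}}\big(f(u_{n,\ast}^{h}),v^{h}\big)=0,$$ $$\frac{r_{n,\alpha}^{h}}{\widehat{k}_{n}}=\frac{1}{2\sqrt{E(u_{n,\ast}^{h})+C_{0}}}\Big(f(u_{n,\ast}^{h}),\frac{u_{n,\alpha}^{h}}{\widehat{k}_{n}}\Big).$$ Define, for $n=1,\dots,N$, the discrete model energy $$\mathcal{E}_{n}^{\mathrm{SAV}}=\epsilon^2\Big(\tfrac14(1+\theta)\|\nabla u_n^h\|^2+\tfrac14(1-\theta)\|\nabla u_{n-1}^h\|^2\Big)+\frac{1+\theta}{2}(r_n^h)^2+\frac{1-\theta}{2}(r_{n-1}^h)^2 .$$ Then $$\mathcal{E}_{n+1}^{\mathrm{SAV}}\le\mathcal{E}_{n}^{\mathrm{SAV}},\qquad n=1,2,\dots,N-1;$$ that is, the DLN-SAV algorithm is unconditionally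 stable with respect to this model energy.
   Context: $\Omega\subset\mathbb{R}^d$ ($d=1,2,3$) is the spatial domain; $(\cdot,\cdot)$ and $\|\cdot\|$ are the $L^2(\Omega)$ inner product and norm. $X_s^h\subset H^1(\Omega)$ is a standard finite element space with highest polynomial degree $s$ and mesh diameter $h>0$. $F(u)=\frac14(u^2-1)^2$, $f(u)=F'(u)=u^3-u$, and $E(u)=\int_\Omega F(u)\,dx\ge0$. Time steps: $k_n=t_{n+1}-t_n$, step variability $\varepsilon_n=(k_n-k_{n-1})/(k_n+k_{n-1})$, average step $\widehat k_n=\alpha_2k_n-\alpha_0k_{n-1}$. DLN coefficients with parameter $\theta\in[0,1]$: $\alpha_2=\frac12(\theta+1)$, $\alpha_1=-\theta$, $\alpha_0=\frac12(\theta-1)$, and $$\beta_2^{(n)}=\tfrac14\Big(1+\tfrac{1-\theta^2}{(1+\varepsilon_n\theta)^2}+\varepsilon_n^2\tfrac{\theta(1-\theta^2)}{(1+\varepsilon_n\theta)^2}+\theta\Big),\quad \beta_1^{(n)}=\tfrac12\Big(1-\tfrac{1-\theta^2}{(1+\varepsilon_n\theta)^2}\Big),\quad \beta_0^{(n)}=\tfrac14\Big(1+\tfrac{1-\theta^2}{(1+\varepsilon_n\theta)^2}-\varepsilon_n^2\tfrac{\theta(1-\theta^2)}{(1+\varepsilon_n\theta)^2}-\theta\Big).$$ For a sequence $\{z_n\}$: $z_{n,\alpha}=\sum_{\ell=0}^2\alpha_\ell z_{n-1+\ell}$, $z_{n,\beta}=\sum_{\ell=0}^2\beta_\ell^{(n)}z_{n-1+\ell}$,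 and $$z_{n,\ast}=\beta_2^{(n)}\Big[\big(1+\tfrac{k_n}{k_{n-1}}\big)z_n-\tfrac{k_n}{k_{n-1}}z_{n-1}\Big]+\beta_1^{(n)}z_n+\beta_0^{(n)}z_{n-1}.$$ *)

(* Defs.v *)
From HB Require Import structures.
From mathcomp Require Import all_boot all_order all_algebra.
From mathcomp Require Import all_classical all_reals all_analysis.
From mathcomp Require Import measurable_realfun ring lra.
Set Implicit Arguments.
Unset Strict Implicit.
Unset Printing Implicit Defensive.
Import Order.TTheory GRing.Theory Num.Theory.
Import numFieldNormedType.Exports.
Local Open Scope classical_set_scope.
Local Open Scope ring_scope.

(* R^d is 'rV[R]_d with the product (that is, Borel) sigma-algebra generated
   by the coordinates, see open_measurable_rV.  Its Lebesgue measure is the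
   d-fold product of the one-dimensional one, see lebesgue_rV_box. *)
Section lebesgue_rV.
Variable R : realType.

Let coords d : 'I_d -> 'rV[R]_d -> measurableTypeR R := fun i x => x 0 i.

Let rV_set0 d : g_sigma_preimage (@coords d) set0.
Proof. exact: sigma_algebra0. Qed.

Let rV_setC d A :
  g_sigma_preimage (@coords d) A -> g_sigma_preimage (@coords d) (~` A).
Proof. exact: sigma_algebraC. Qed.

Let rV_bigcup d (F : (set 'rV[R]_d)^nat) :
  (forall i, g_sigma_preimage (@coords d) (F i)) ->
  g_sigma_preimage (@coords d) (\bigcup_i (F i)).
Proof. exact: sigma_algebra_bigcup. Qed.

HB.instance Definition _ d := @isMeasurable.Build default_measure_display
  'rV[R]_d (g_sigma_preimage (@coords d)) (@rV_set0 d) (@rV_setC d)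
  (@rV_bigcup d).

Lemma measurable_coord d (i : 'I_d) :
  measurable_fun [set: 'rV[R]_d] (fun x => x 0 i : R).
Proof.
move=> _ Y mY; rewrite setTI; apply: sub_sigma_algebra => /=.
rewrite -bigcup_seq/=; exists i => /=; first by rewrite mem_index_enum.
by exists Y => //; rewrite setTI.
Qed.

Lemma measurable_to_rV d disp (T : measurableType disp) (f : T -> 'rV[R]_d) :
  (forall i, measurable_fun [set: T] (fun x => f x 0 i : R)) ->
  measurable_fun [set: T] f.
Proof.
move=> mf.
have : g_sigma_preimage (fun i => @coords d i \o f) `<=` measurable.
  apply: smallest_sub; first exact: sigma_algebra_measurable.
  case: d => [|n] in f mf *; first by rewrite big_ord0.
  rewrite -bigcup_mkord_ord; apply: bigcup_sub => i Ii.
  by move=> A [B mB <-]; exact: mf.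
by rewrite g_sigma_preimage_comp => prefS _ A mA; apply: prefS; exists A.
Qed.

Definition vcons d (p : R * 'rV[R]_d) : 'rV[R]_d.+1 :=
  @row_mx R 1 1 d p.1%:M p.2.

Lemma vcons0 d p : @vcons d p 0 0 = p.1.
Proof.
have e : (0 : 'I_d.+1) = @lshift 1 d 0 by exact: val_inj.
by rewrite [in LHS]e (@row_mxEl R 1 1 d p.1%:M p.2 0 0) mxE eqxx mulr1n.
Qed.

Lemma vconsS d p (i : 'I_d) : vcons p 0 (lift 0 i) = p.2 0 i.
Proof.
have -> : lift 0 i = @rshift 1 d i by exact: val_inj.
by rewrite (@row_mxEr R 1 1 d p.1%:M p.2).
Qed.

Lemma measurable_vcons d :
  measurable_fun [set: measurableTypeR R * 'rV[R]_d] (@vcons d).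
Proof.
apply: measurable_to_rV => i; case: (unliftP 0 i) => [j|] ->.
  under eq_fun do rewrite vconsS.
  exact: (measurableT_comp (@measurable_coord d j) measurable_snd).
under eq_fun do rewrite vcons0.
exact: measurable_fst.
Qed.

Lemma vcons_image d (A : set R) (B : set 'rV[R]_d) :
  @vcons d @^-1` [set x | A (x 0 0) /\ B (\row_j x 0 (lift 0 j))] = A `*` B.
Proof.
apply/seteqP; split=> -[a b] /=; rewrite vcons0.
all: by rewrite (_ : \row_j _ = b) //; apply/rowP => j; rewrite mxE vconsS.
Qed.

Lemma measurable_cylinder d (A : set R) (B : set 'rV[R]_d) :
  measurable (A : set (measurableTypeR R)) -> measurable B ->
  measurable [set x : 'rV[R]_d.+1 | A (x 0 0) /\ B (\row_j x 0 (lift 0 j))].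
Proof.
move=> mA mB; apply: measurableI.
  have := @measurable_coord d.+1 0 measurableT _ mA; by rewrite setTI.
have mp : measurable_fun [set: 'rV[R]_d.+1] (fun x => \row_j x 0 (lift 0 j)).
  apply: measurable_to_rV => i.
  under eq_fun do rewrite mxE.
  exact: measurable_coord.
by have := mp measurableT _ mB; rewrite setTI.
Qed.

Section step.
Variables (d : nat) (mu : {sigma_finite_measure set 'rV[R]_d -> \bar R}).

Definition lebesgue_rV_step : set 'rV[R]_d.+1 -> \bar R :=
  pushforward (@lebesgue_measure R \x mu)%E (@vcons d).


Let lebesgue_rV_step0 : lebesgue_rV_step set0 = 0%E.
Proof. by rewrite /lebesgue_rV_step /pushforward preimage_set0 measure0. Qed.

Let lebesgue_rV_step_ge0 A : (0 <= lebesgue_rV_step A)%E.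
Proof. by rewrite /lebesgue_rV_step /pushforward; exact: measure_ge0. Qed.

Let lebesgue_rV_step_additive : semi_sigma_additive lebesgue_rV_step.
Proof.
have mv A : measurable A -> measurable (@vcons d @^-1` A).
  by move=> mA; have := measurable_vcons measurableT mA; rewrite setTI.
move=> F mF tF mUF; rewrite /lebesgue_rV_step /pushforward preimage_bigcup.
apply: measure_semi_sigma_additive.
- by move=> n; exact: mv.
- apply/trivIsetP => /= i j _ _ ij; rewrite -preimage_setI.
  by move/trivIsetP : tF => /(_ _ _ _ _ ij) ->//; rewrite preimage_set0.
- by rewrite -preimage_bigcup; exact: mv.
Qed.

HB.instance Definition _ := isMeasure.Build _ _ _ lebesgue_rV_step
  lebesgue_rV_step0 lebesgue_rV_step_ge0 lebesgue_rV_step_additive.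

Let lebesgue_rV_step_sigma_finite : sigma_finite setT lebesgue_rV_step.
Proof.
have /sigma_finiteP[F [TF ndF Foo]] := sigma_finiteT (@lebesgue_measure R).
have /sigma_finiteP[G [TG ndG Goo]] := sigma_finiteT mu.
exists (fun n => [set x : 'rV[R]_d.+1 | F n (x 0 0) /\ G n (\row_j x 0 (lift 0 j))]).
  apply/seteqP; split=> // x _.
  have [n _ Fn] : (\bigcup_i F i) (x 0 0) by rewrite -TF.
  have [k _ Gk] : (\bigcup_i G i) (\row_j x 0 (lift 0 j)) by rewrite -TG.
  exists (maxn n k) => //; split.
  - by move: Fn; exact/subsetPset/ndF/leq_maxl.
  - by move: Gk; exact/subsetPset/ndG/leq_maxr.
move=> k; have [mF Fk] := Foo k; have [mG Gk] := Goo k.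
split; first exact: measurable_cylinder.
rewrite /lebesgue_rV_step /pushforward vcons_image product_measure1E//.
by rewrite lte_mul_pinfty// ge0_fin_numE.
Qed.

HB.instance Definition _ := Measure_isSigmaFinite.Build _ _ _ lebesgue_rV_step
  lebesgue_rV_step_sigma_finite.

Lemma lebesgue_rV_stepE (A : set R) (B : set 'rV[R]_d) :
  measurable (A : set (measurableTypeR R)) -> measurable B ->
  lebesgue_rV_step [set x | A (x 0 0) /\ B (\row_j x 0 (lift 0 j))] =
  (lebesgue_measure A * mu B)%E.
Proof.
move=> mA mB.
by rewrite /lebesgue_rV_step /pushforward vcons_image product_measure1E.
Qed.

End step.

Fixpoint lebesgue_rV d : {sigma_finite_measure set 'rV[R]_d -> \bar R} :=
  if d is d'.+1 then lebesgue_rV_step (lebesgue_rV d') 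
  else \d_ (0 : 'rV[R]_0).

Lemma measurable_prod_rV d (P : 'I_d -> set R) :
  (forall i, measurable (P i : set (measurableTypeR R))) ->
  measurable [set x : 'rV[R]_d | forall i, P i (x 0 i)].
Proof.
move=> mP.
have mB : measurable
    (\big[setI/setT]_(i < d) [set x : 'rV[R]_d | P i (x 0 i)]).
  apply: bigsetI_measurable => i _.
  by have := @measurable_coord d i measurableT _ (mP i); rewrite setTI.
apply: (eq_ind _ (fun A : set 'rV[R]_d => measurable A) mB).
rewrite -bigcap_seq; apply/seteqP; split=> x /= xP i.
  by apply: xP; rewrite /= mem_index_enum.
by move=> _; exact: xP.
Qed.

Lemma measurable_box d (a b : 'rV[R]_d) :
  measurable [set x : 'rV[R]_d | forall i, a 0 i <= x 0 i <= b 0 i].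
Proof.
apply: (@measurable_prod_rV d (fun i => [set t | a 0 i <= t <= b 0 i])) => i.
by have := measurable_itv `[a 0 i, b 0 i]; rewrite set_itvE.
Qed.

Lemma lebesgue_rV_box d (a b : 'rV[R]_d) :
  (forall i, a 0 i <= b 0 i) ->
  lebesgue_rV d [set x | forall i, a 0 i <= x 0 i <= b 0 i] =
  (\prod_i (b 0 i - a 0 i))%:E.
Proof.
elim: d a b => [|d IHd] a b ab.
  rewrite big_ord0 /= /dirac indicE mem_set//; by case.
rewrite big_ord_recl EFinM.
have ab' i : (\row_j a 0 (lift 0 j)) 0 i <= (\row_j b 0 (lift 0 j)) 0 i.
  by rewrite !mxE.
have := IHd _ _ ab'.
under eq_bigr do rewrite !mxE.
move=> <-.
transitivity (lebesgue_rV d.+1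
  [set x | `[a 0 0, b 0 0]%classic (x 0 0) /\
   [set x | forall i, (\row_j a 0 (lift 0 j)) 0 i <= x 0 i <=
      (\row_j b 0 (lift 0 j)) 0 i] (\row_j x 0 (lift 0 j))]).
  congr (lebesgue_rV d.+1 _); apply/seteqP; split=> x /=.
    by move=> abx; split=> [|i]; rewrite ?in_itv ?mxE//=.
  case; rewrite in_itv/= => abx0 abx i; case: (unliftP 0 i) => [j|] -> //.
  by have := abx j; rewrite !mxE.
have mI : measurable (`[a 0 0, b 0 0]%classic : set (measurableTypeR R)).
  exact: measurable_itv.
rewrite [LHS](lebesgue_rV_stepE _ mI (@measurable_box _ _ _)).
rewrite lebesgue_measure_itv/= lte_fin.
by case: ltgtP (ab 0) => // ->; rewrite subrr.
Qed.

Lemma open_measurable_rV d (U : set 'rV[R]_d) : open U -> measurable U.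
Proof.
move=> oU.
pose q2x (q : 'rV[rat]_d) : 'rV[R]_d := map_mx ratr q.
pose cube (p : 'rV[rat]_d * nat) :=
  [set x : 'rV[R]_d | forall i, `]q2x p.1 0 i - p.2.+1%:R^-1,
                                  q2x p.1 0 i + p.2.+1%:R^-1[%classic (x 0 i)].
pose F p := if `[< cube p `<=` U >] then cube p else set0.
have mF p : measurable (F p).
  rewrite /F; case: ifP => _ //.
  apply: (@measurable_prod_rV d (fun i => `]q2x p.1 0 i - p.2.+1%:R^-1,
    q2x p.1 0 i + p.2.+1%:R^-1[%classic)) => i; exact: measurable_itv.
have mUF : measurable (\bigcup_p F p).
  by apply: countable_bigcupT_measurable => //; exact: countableP.
apply: (eq_ind _ (fun A : set 'rV[R]_d => measurable A) mUF).
apply/seteqP; split=> [x [p _]|x Ux].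
  by rewrite /F; case: asboolP => // pU px; exact: pU.
have /nbhs_ballP[e /= e0 eU] := open_nbhs_nbhs (conj oU Ux).
have [n ne] : exists n : nat, n.+1%:R^-1 < e / 2.
  by have [|n] := @ltr_add_invr R 0 (e / 2); [lra|rewrite add0r; exists n].
have n0 : (0 : R) < n.+1%:R^-1 by rewrite invr_gt0.
have qx i : exists q : rat, ratr q \in `]x 0 i - n.+1%:R^-1, x 0 i + n.+1%:R^-1[.
  by apply: rat_in_itvoo; rewrite ltrD2l (lt_trans _ n0)// oppr_lt0.
pose q : 'rV[rat]_d := \row_i xchoose (qx i).
have qP i : ratr (q 0 i) \in `]x 0 i - n.+1%:R^-1, x 0 i + n.+1%:R^-1[.
  by rewrite mxE; exact: (xchooseP (qx i)).
clearbody q.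
exists (q, n) => //; rewrite /F asboolT.
  move=> i /=; have := qP i; rewrite !in_itv/= mxE => /andP[? ?].
  by apply/andP; split; [rewrite ltrBlDr|rewrite -ltrBlDr].
move=> y /= qy; apply: eU; split=> // i j; rewrite (ord1 i).
rewrite -ball_normE /=; have := qP j; have := qy j.
rewrite !in_itv/= mxE => /andP[yq1 yq2] /andP[xq1 xq2].
have aux (a b r c : R) : c < e / 2 -> r - c < b -> b < r + c ->
    a - c < r -> r < a + c -> `|a - b| < e.
  by move=> *; rewrite ltr_norml; apply/andP; split; lra.
exact: (aux _ _ _ _ ne yq1 yq2 xq1 xq2).
Qed.

Lemma continuous_measurable_rV d (f : 'rV[R]_d -> R) :
  continuous f -> measurable_fun setT f.
Proof.
move=> /continuousP cf; apply: (measurability _ (RGenOpens.measurableE R)).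
move=> _ [_ [a [b ->] <-]]; rewrite setTI.
by apply: open_measurable_rV; apply: cf; exact: interval_open.
Qed.

End lebesgue_rV.

Section sobolev.
Variables (R : realType) (d : nat).
Implicit Types (Omega : set 'rV[R]_d) (f g u v phi : 'rV[R]_d -> R).

Local Notation leb := (lebesgue_rV R d).

Definition partial (i : 'I_d) f : 'rV[R]_d -> R := 'D_(delta_mx 0 i) f.

Definition iter_partial (s : seq 'I_d) f := foldr partial f s.

Definition smooth f := forall s : seq 'I_d,
  continuous (iter_partial s f) /\
  forall x i, derivable (iter_partial s f) x (delta_mx 0 i).

(* C^oo functions with compact support in Omega *)
Definition test_function Omega phi := smooth phi /\
  exists K, [/\ compact K, K `<=` Omega & forall x, ~ K x -> phi x = 0].

Definition in_L2 Omega f := f \_ Omega \in Lfun leb 2%:E.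

Definition is_weak_gradient Omega u (g : 'I_d -> 'rV[R]_d -> R) :=
  forall i phi, test_function Omega phi ->
    \int[leb]_(x in Omega) (u x * partial i phi x) =
    - \int[leb]_(x in Omega) (g i x * phi x).

Lemma continuous_compact_support_Lfun2 f K :
  continuous f -> compact K -> (forall x, ~ K x -> f x = 0) ->
  f \in Lfun leb 2%:E.
Proof.
move=> cf cK f0.
have mf : measurable_fun setT f := continuous_measurable_rV cf.
rewrite inE; apply/andP; split; rewrite inE//= /finite_norm unlock /Lnorm.
rewrite poweR_lty//.
have [M [_ fM]] := compact_bounded (continuous_compact
  (continuous_subspaceT cf : {within K, continuous f}) cK).
have [N [_ KN]] := compact_bounded cK.
pose m := `|M| + 1; pose n := `|N| + 1.
pose B := [set x : 'rV[R]_d | forall i,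
  (const_mx (- n) : 'rV[R]_d) 0 i <= x 0 i <= (const_mx n : 'rV[R]_d) 0 i].
have mB : measurable B by exact: measurable_box.
have KB : K `<=` B.
  move=> x Kx i; rewrite !mxE -ler_norml.
  have : `|x| <= n.
    by apply: KN => //; rewrite /n ltr_pwDr// ler_norm.
  apply: le_trans; rewrite [leRHS]mx_normrE.
  exact: (le_bigmax _ (fun ij => `|x ij.1 ij.2|) (0, i)).
apply: (@le_lt_trans _ _ (\int[leb]_x (m ^+ 2 * \1_B x)%:E)%E).
  apply: ge0_le_integral => //=.
  - apply/measurable_EFinP; under eq_fun do rewrite powR_mulrn//.
    by apply: measurable_funX; exact: measurableT_comp.
  - by apply/measurable_EFinP; apply: measurable_funM.
  - move=> x _; rewrite lee_fin powR_mulrn//.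
    have [Kx|Kx] := pselect (K x); last first.
      by rewrite f0// normr0 expr0n/= mulr_ge0// sqr_ge0.
    rewrite indicE mem_set ?mulr1; last exact: KB.
    rewrite lerXn2r// ?nnegrE ?addr_ge0//.
    by apply: fM; [rewrite ltr_pwDr// ler_norm|exists x].
under eq_integral do rewrite EFinM.
rewrite ge0_integralZl//=; last 2 first.
- by apply/measurable_EFinP.
- by rewrite lee_fin sqr_ge0.
have BE := @lebesgue_rV_box R d (const_mx (- n)) (const_mx n).
rewrite integral_indic// setIT [X in (_ * X)%E]BE; last first.
  by move=> i; rewrite !mxE ge0_cp// addr_ge0.
by rewrite -EFinM ltry.
Qed.

Lemma test_function_Lfun2 Omega phi : test_function Omega phi ->
  phi \in Lfun leb 2%:E.
Proof.
move=> [sphi [K [cK _ phi0]]].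
by apply: continuous_compact_support_Lfun2 cK phi0; have [] := sphi [::].
Qed.

Lemma partial_test_function_Lfun2 Omega phi i : test_function Omega phi ->
  partial i phi \in Lfun leb 2%:E.
Proof.
move=> [sphi [K [cK _ phi0]]].
apply: (@continuous_compact_support_Lfun2 _ K) => //.
  by have [] := sphi [:: i].
move=> x Kx; rewrite /partial -[RHS](derive_cst 0 x (delta_mx 0 i)).
apply: near_eq_derive.
have /open_nbhs_nbhs : open_nbhs x (~` K).
  by split=> //; apply: closed_openC; apply: compact_closed.
by apply: filterS => y /phi0.
Qed.

Let restr_comb Omega a f g :
  (a *: f + g) \_ Omega = a *: (f \_ Omega) + (g \_ Omega).
Proof.
apply/funext => x; rewrite !fctE /patch; case: ifP => // _.
by rewrite scaler0 addr0.
Qed.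

Lemma in_L2_comb Omega a f g :
  in_L2 Omega f -> in_L2 Omega g -> in_L2 Omega (a *: f + g).
Proof.
rewrite /in_L2 restr_comb => fL gL.
have p1 : (1 <= 2%:E :> \bar R)%E by rewrite lee_fin ler1n.
exact: (Lfun_submod_closed leb p1).2.
Qed.

Lemma Rintegral_in_L2_comb Omega a f g h :
  in_L2 Omega f -> in_L2 Omega g -> h \in Lfun leb 2%:E ->
  \int[leb]_(x in Omega) ((a *: f + g) x * h x) =
  a * \int[leb]_(x in Omega) (f x * h x) + \int[leb]_(x in Omega) (g x * h x).
Proof.
move=> fL gL hL.
have ih k : in_L2 Omega k ->
    leb.-integrable setT (EFin \o (fun x => (k \_ Omega) x * h x)).
  by move=> kL; apply/Lfun1_integrable; exact: Lfun2_mul_Lfun1.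
have Eh k : \int[leb]_(x in Omega) (k x * h x) =
    \int[leb]_x ((k \_ Omega) x * h x).
  rewrite Rintegral_mkcond; apply: eq_Rintegral => x _.
  by rewrite /patch; case: ifP => //; rewrite mul0r.
rewrite !Eh restr_comb.
rewrite -RintegralZl//; last exact: ih.
rewrite -RintegralD//; last 2 first.
- exact: (integrableZl measurableT a (ih _ fL)).
- exact: ih.
by apply: eq_Rintegral => x _; rewrite mulrA -mulrDl.
Qed.

Definition is_H1 Omega u (g : 'I_d -> 'rV[R]_d -> R) :=
  [/\ in_L2 Omega u, forall i, in_L2 Omega (g i) & is_weak_gradient Omega u g].

(* An element of H^1(Omega) is represented by a function together with a
   representative of its weak gradient, which is unique up to a null set.  This
   makes H^1(Omega) a vector space on which the gradient is linear on the
   nose. *)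
Definition H1_pred Omega : {pred ('rV[R]_d -> R) * ('I_d -> 'rV[R]_d -> R)} :=
  [pred ug | `[< is_H1 Omega ug.1 ug.2 >]].

Lemma H1_predP Omega ug :
  reflect (is_H1 Omega ug.1 ug.2) (ug \in H1_pred Omega).
Proof. exact: asboolP. Qed.

Lemma in_L2_0 Omega : in_L2 Omega 0.
Proof.
rewrite /in_L2 (_ : 0 \_ Omega = 0).
  have p1 : (1 <= 2%:E :> \bar R)%E by rewrite lee_fin ler1n.
  exact: (Lfun_submod_closed leb p1).1.
by apply/funext => x; rewrite /patch; case: ifP.
Qed.

Lemma Rintegral_mul0 Omega h : \int[leb]_(x in Omega) (0 * h x) = 0.
Proof.
rewrite /Rintegral integral0_eq// => x _; by rewrite mul0r.
Qed.

Lemma H1_submod_closed Omega : submod_closed (H1_pred Omega).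
Proof.
split=> [|a [u g] [v h] /H1_predP[/= uL gL ug] /H1_predP[/= vL hL vh]].
  apply/H1_predP; split=> [|i|i phi tphi] /=; [exact: in_L2_0..|].
  by rewrite [LHS]Rintegral_mul0 [X in - X]Rintegral_mul0 oppr0.
apply/H1_predP; split=> [|i|i phi tphi] /=.
- exact: in_L2_comb.
- exact: in_L2_comb.
- rewrite [LHS]Rintegral_in_L2_comb//; last first.
    exact: partial_test_function_Lfun2 tphi.
  rewrite [X in - X]Rintegral_in_L2_comb//; last first.
    exact: test_function_Lfun2 tphi.
  by rewrite ug// vh// mulrN opprD.
Qed.

HB.instance Definition _ Omega :=
  GRing.isSubmodClosed.Build R _ (H1_pred Omega) (H1_submod_closed Omega).

Record H1 Omega := MkH1 { H1_pair : _ ; H1_pairP : H1_pair \in H1_pred Omega }.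

HB.instance Definition _ Omega := [isSub for @H1_pair Omega].
HB.instance Definition _ Omega := [Choice of H1 Omega by <:].
HB.instance Definition _ Omega := [SubChoice_isSubLmodule of H1 Omega by <:].

Definition H1_fun Omega (u : H1 Omega) : 'rV[R]_d -> R := (H1_pair u).1.

Definition grad Omega (u : H1 Omega) : 'I_d -> 'rV[R]_d -> R := (H1_pair u).2.

Definition L2_inner Omega f g : R := \int[leb]_(x in Omega) (f x * g x).

Definition L2_inner_vec Omega (F G : 'I_d -> 'rV[R]_d -> R) : R :=
  \int[leb]_(x in Omega) \sum_(i < d) (F i x * G i x).

Definition L2_norm_vec Omega (F : 'I_d -> 'rV[R]_d -> R) : R :=
  Num.sqrt (L2_inner_vec Omega F F).

End sobolev.

Coercion H1_fun : H1 >-> Funclass.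

Section finite_elements.
Variables (R : realType) (d : nat).

(* A d-simplex is given by the matrix whose d.+1 rows are its vertices; a face
   is the convex hull of the vertices selected by S (empty when S is). *)
Definition face (P : 'M[R]_(d.+1, d)) (S : pred 'I_d.+1) : set 'rV[R]_d :=
  [set x | exists l : 'rV[R]_d.+1,
    [/\ forall j, 0 <= l 0 j, forall j, ~~ S j -> l 0 j = 0,
        \sum_j l 0 j = 1 & x = l *m P]].

Definition simplex (P : 'M[R]_(d.+1, d)) : set 'rV[R]_d := face P predT.

Definition affinely_independent (P : 'M[R]_(d.+1, d)) :=
  forall l : 'rV[R]_d.+1, \sum_j l 0 j = 0 -> l *m P = 0 -> l = 0.

(* Euclidean: the norm of 'rV[R]_d is the sup norm. *)
Definition euclidean_dist (x y : 'rV[R]_d) : R :=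
  Num.sqrt (\sum_(i < d) (x 0 i - y 0 i) ^+ 2).

Definition diameter (A : set 'rV[R]_d) : R :=
  sup [set euclidean_dist p.1 p.2 | p in A `*` A].

Definition mesh_size (Th : seq 'M[R]_(d.+1, d)) : R :=
  \big[Num.max/0]_(P <- Th) diameter (simplex P).

Definition triangulation (Omega : set 'rV[R]_d) (Th : seq 'M[R]_(d.+1, d)) :=
  [/\ forall P, P \in Th -> affinely_independent P,
      closure Omega = [set x | exists2 P, P \in Th & simplex P x] &
      forall P Q, P \in Th -> Q \in Th -> exists S S' : pred 'I_d.+1,
        simplex P `&` simplex Q = face P S /\
        simplex P `&` simplex Q = face Q S'].

Definition polynomial_le (s : nat) (p : 'rV[R]_d -> R) :=
  exists c : {ffun 'I_d -> 'I_s.+1} -> R, forall x,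
    p x = \sum_(m : {ffun 'I_d -> 'I_s.+1} | (\sum_i m i <= s)%N)
            c m * \prod_i x 0 i ^+ m i.

(* the Lagrange space of continuous piecewise polynomials of degree <= s *)
Definition fe_space (Omega : set 'rV[R]_d) (Th : seq 'M[R]_(d.+1, d))
    (s : nat) : set (H1 Omega) :=
  [set v : H1 Omega | {within closure Omega, continuous (v : 'rV[R]_d -> R)} /\
    forall P, P \in Th -> exists2 p, polynomial_le s p &
      forall x, simplex P x -> v x = p x].

Definition domain (Omega : set 'rV[R]_d) :=
  [/\ open Omega, connected Omega & Omega !=set0].

End finite_elements.

Section DLN.
Variable R : realType.
Implicit Types (t : nat -> R) (theta : R).

Definition time_step t n : R := t n.+1 - t n.

Definition variability t n : R :=
  (time_step t n - time_step t n.-1) / (time_step t n + time_step t n.-1).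

Definition alpha2 theta : R := (theta + 1) / 2.
Definition alpha1 theta : R := - theta.
Definition alpha0 theta : R := (theta - 1) / 2.

Definition beta2 theta e : R :=
  4^-1 * (1 + (1 - theta ^+ 2) / (1 + e * theta) ^+ 2
    + e ^+ 2 * (theta * (1 - theta ^+ 2) / (1 + e * theta) ^+ 2) + theta).
Definition beta1 theta e : R :=
  2^-1 * (1 - (1 - theta ^+ 2) / (1 + e * theta) ^+ 2).
Definition beta0 theta e : R :=
  4^-1 * (1 + (1 - theta ^+ 2) / (1 + e * theta) ^+ 2
    - e ^+ 2 * (theta * (1 - theta ^+ 2) / (1 + e * theta) ^+ 2) - theta).

Definition avg_step theta t n : R :=
  alpha2 theta * time_step t n - alpha0 theta * time_step t n.-1.

(* z_{n,alpha}, z_{n,beta} and z_{n,*}; they are used for n >= 1 only. *)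
Definition dln_alpha theta (V : lmodType R) (z : nat -> V) n : V :=
  alpha2 theta *: z n.+1 + alpha1 theta *: z n + alpha0 theta *: z n.-1.

Definition dln_beta theta t (V : lmodType R) (z : nat -> V) n : V :=
  let e := variability t n in
  beta2 theta e *: z n.+1 + beta1 theta e *: z n + beta0 theta e *: z n.-1.

Definition dln_star theta t (V : lmodType R) (z : nat -> V) n : V :=
  let e := variability t n in
  let rho := time_step t n / time_step t n.-1 in
  beta2 theta e *: ((1 + rho) *: z n - rho *: z n.-1)
  + beta1 theta e *: z n + beta0 theta e *: z n.-1.

End DLN.

Section SAV.
Variables (R : realType) (d : nat) (Omega : set 'rV[R]_d).
Variables (theta eps C0 : R).

Definition potential (x : R) : R := 4^-1 * (x ^+ 2 - 1) ^+ 2.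
Definition potential' (x : R) : R := x ^+ 3 - x.

Definition potential_energy (u : 'rV[R]_d -> R) : R :=
  \int[lebesgue_rV R d]_(x in Omega) potential (u x).

Definition dln_sav_step (Xh : set (H1 Omega)) (t : nat -> R)
    (u : nat -> H1 Omega) (r : nat -> R) (n : nat) :=
  let khat := avg_step theta t n in
  let u_alpha := dln_alpha theta u n in
  let u_beta := dln_beta theta t u n in
  let u_star := dln_star theta t u n in
  let r_alpha := dln_alpha theta (r : nat -> R^o) n in
  let r_beta := dln_beta theta t (r : nat -> R^o) n in
  let q := Num.sqrt (potential_energy u_star + C0) in
  let f_star := potential' \o u_star in
  (forall v, Xh v ->
    L2_inner Omega (khat^-1 *: u_alpha) v
    + eps ^+ 2 * L2_inner_vec Omega (grad u_beta) (grad v)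
    + r_beta / q * L2_inner Omega f_star v = 0) /\
  r_alpha / khat = (2 * q)^-1 * L2_inner Omega f_star (khat^-1 *: u_alpha).

Definition sav_energy (u : nat -> H1 Omega) (r : nat -> R) (n : nat) : R :=
  eps ^+ 2 * (4^-1 * (1 + theta) * L2_norm_vec Omega (grad (u n)) ^+ 2
    + 4^-1 * (1 - theta) * L2_norm_vec Omega (grad (u n.-1)) ^+ 2)
  + (1 + theta) / 2 * r n ^+ 2 + (1 - theta) / 2 * r n.-1 ^+ 2.

End SAV.

(* Main.v *)
Require Import Defs.
From HB Require Import structures.
From mathcomp Require Import all_boot all_order all_algebra.
From mathcomp Require Import all_classical all_reals all_analysis.
From mathcomp Require Import ring lra.
Set Implicit Arguments.
Unset Strict Implicit.
Unset Printing Implicit Defensive.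
Import Order.TTheory GRing.Theory Num.Theory.
Import numFieldNormedType.Exports.
Local Open Scope classical_set_scope.
Local Open Scope ring_scope.

(** The proof is an energy argument.  Testing the first equation with
    [v = u_alpha / khat], which lies in the finite element space since that
    space is a linear subspace, makes the nonlinear term equal to
    [r_beta / q * (f_star, u_alpha / khat)], and the scalar equation is designed
    so that this is [2 * r_alpha * r_beta / khat]: the nonlinearity disappears.
    What is left of the first term is a square, whence
    [eps ^ 2 * (grad u_alpha, grad u_beta) + 2 * r_alpha * r_beta <= 0].

    Both products pair the alpha-combination of a sequence with its
    beta-combination in a positive semidefinite symmetric bilinear form.  The
    DLN coefficients satisfy Dahlquist's G-stability identity
    ([dln_G_identity]) on every grid: such a pairing is the increment
    of the quadratic form [G_norm], whose weights do not depend on the step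
    sizes, plus a nonnegative dissipation term.  Since the model energy is
    [eps ^ 2] times the [G_norm] of the gradients plus twice the [G_norm] of the
    scalar variable, it cannot increase. *)

(** * G-stability of the DLN coefficients *)

Section G_stability.
Variables (R : realType) (V : lmodType R) (B : V -> V -> R).
Hypothesis B_comb : forall a x y z, B (a *: x + y) z = a * B x z + B y z.
Hypothesis BC : forall x y, B x y = B y x.
Hypothesis B_ge0 : forall x, 0 <= B x x.

Lemma form_scale a x z : B (a *: x) z = a * B x z.
Proof.
have := B_comb (a - 1) x x z; rewrite scalerBl scale1r subrK => ->.
by rewrite mulrBl mul1r subrK.
Qed.

Lemma form_comb3 a b c x y z w :
  B (a *: x + b *: y + c *: z) w = a * B x w + b * B y w + c * B z w.
Proof. by rewrite -addrA !B_comb form_scale addrA. Qed.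

Definition G_norm theta x y : R :=
  4^-1 * (1 + theta) * B x x + 4^-1 * (1 - theta) * B y y.

(** The beta-coefficients are chosen so that, as quadratic forms in three
    consecutive terms, the pairing minus the increment of [G_norm] has rank one:
    it is a multiple of the square of [w], the amount by which the middle term
    differs from a convex combination of its two neighbours. *)
Lemma dln_G_identity theta t (z : nat -> V) n :
  let e := variability t n in
  let w := - ((1 - e) / 2) *: z n.+1 + 1 *: z n
           + - ((1 + e) / 2) *: z n.-1 in
  1 + e * theta != 0 ->
  B (dln_alpha theta z n) (dln_beta theta t z n) =
  G_norm theta (z n.+1) (z n) - G_norm theta (z n) (z n.-1)
  + theta * (1 - theta ^+ 2) / (2 * (1 + e * theta) ^+ 2) * B w w.
Proof.
move=> e w e0; rewrite /w /G_norm /dln_alpha /dln_beta -/e !form_comb3.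
rewrite !(BC _ (_ + _)) !form_comb3.
rewrite (BC (z n) (z n.+1)) (BC (z n.-1) (z n.+1)) (BC (z n.-1) (z n)).
by rewrite /alpha0 /alpha1 /alpha2 /beta0 /beta1 /beta2; field.
Qed.

(** Positive steps force the variability to lie strictly between -1 and 1,
    which keeps the denominator of the beta-coefficients away from zero. *)
Lemma variability_denom_gt0 (theta : R) t n : 0 <= theta <= 1 ->
  0 < time_step t n -> 0 < time_step t n.-1 ->
  0 < 1 + variability t n * theta.
Proof.
rewrite /variability; move: (time_step t n) (time_step t n.-1) => a b.
move=> /andP[th0 th1] a0 b0.
have -> : 1 + (a - b) / (a + b) * theta =
    ((1 + theta) * a + (1 - theta) * b) / (a + b).
  by field; rewrite gt_eqF// addr_gt0.
by apply: divr_gt0; [nra|exact: addr_gt0].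
Qed.

Lemma dln_G_stability theta t (z : nat -> V) n : 0 <= theta <= 1 ->
  0 < time_step t n -> 0 < time_step t n.-1 ->
  G_norm theta (z n.+1) (z n) - G_norm theta (z n) (z n.-1) <=
  B (dln_alpha theta z n) (dln_beta theta t z n).
Proof.
move=> th a0 b0; have e0 := variability_denom_gt0 th a0 b0.
rewrite dln_G_identity ?gt_eqF// lerDl mulr_ge0// divr_ge0//.
  by case/andP: th => th0 th1; rewrite mulr_ge0// subr_ge0 expr_le1.
by rewrite mulr_ge0// exprn_ge0// ltW.
Qed.

End G_stability.

Lemma avg_step_gt0 (R : realType) (theta : R) t n : 0 <= theta <= 1 ->
  0 < time_step t n -> 0 < time_step t n.-1 -> 0 < avg_step theta t n.
Proof.
rewrite /avg_step /alpha2 /alpha0.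
move: (time_step t n) (time_step t n.-1) => a b /andP[th0 th1] a0 b0.
by nra.
Qed.

(** Typing the arguments in [R^o] lets the scalar variable share the module
    lemmas with the finite element functions. *)
Definition mul_form (R : realType) (x y : R^o) : R := (x : R) * (y : R).

Lemma mul_form_G_stability (R : realType) (theta : R) t (r : nat -> R^o) n :
  0 <= theta <= 1 -> 0 < time_step t n -> 0 < time_step t n.-1 ->
  G_norm (@mul_form R) theta (r n.+1) (r n)
  - G_norm (@mul_form R) theta (r n) (r n.-1) <=
  mul_form (dln_alpha theta r n) (dln_beta theta t r n).
Proof.
apply: dln_G_stability => [a x y z|x y|x].
- by rewrite /mul_form mulrDl -mulrA.
- exact: mulrC.
- by rewrite /mul_form -expr2 sqr_ge0.
Qed.

(** * The finite element space is a linear subspace *)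

Section finite_element_subspace.
Variables (R : realType) (d : nat) (Omega : set 'rV[R]_d).
Implicit Types (Th : seq 'M[R]_(d.+1, d)) (s : nat) (u v : H1 Omega).

Lemma polynomial_le_comb s a (p q : 'rV[R]_d -> R) :
  polynomial_le s p -> polynomial_le s q -> polynomial_le s (a *: p + q).
Proof.
move=> [c pE] [c' qE]; exists (fun m => a * c m + c' m) => x.
rewrite !fctE /= pE qE /GRing.scale/= mulr_sumr -big_split /=.
by apply: eq_bigr => m _; rewrite mulrDl mulrA.
Qed.

Lemma H1_fun_comb a u v :
  (a *: u + v : H1 Omega) = a *: (u : _ -> _) + (v : _ -> _) :> ('rV[R]_d -> R).
Proof. by []. Qed.

Lemma grad_comb a u v : grad (a *: u + v) = a *: grad u + grad v.
Proof. by []. Qed.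

Lemma fe_space_comb Th s a u v :
  fe_space Th s u -> fe_space Th s v -> fe_space Th s (a *: u + v).
Proof.
move=> [cu pu] [cv pv]; split=> [|P PTh].
  rewrite H1_fun_comb => x.
  by apply: cvgD; [apply: cvgZl_tmp; exact: cu|exact: cv].
have [p ps up] := pu P PTh; have [q qs vq] := pv P PTh.
exists (a *: p + q); first exact: polynomial_le_comb.
by move=> x Px; rewrite H1_fun_comb !fctE up// vq.
Qed.

Lemma fe_space_scale Th s a u : fe_space Th s u -> fe_space Th s (a *: u).
Proof.
move=> us; rewrite (_ : a *: u = (a - 1) *: u + u); first exact: fe_space_comb.
by rewrite scalerBl scale1r subrK.
Qed.

Lemma fe_space_dln_alpha Th s theta (u : nat -> H1 Omega) n :
  fe_space Th s (u n.+1) -> fe_space Th s (u n) -> fe_space Th s (u n.-1) ->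
  fe_space Th s (dln_alpha theta u n).
Proof.
move=> u2 u1 u0; rewrite /dln_alpha -addrA.
by do 2![apply: fe_space_comb => //]; exact: fe_space_scale.
Qed.

End finite_element_subspace.

(** * The Dirichlet form *)

Section dirichlet_form.
Variables (R : realType) (d : nat) (Omega : set 'rV[R]_d).
Implicit Types (F G K : 'I_d -> 'rV[R]_d -> R) (u v w : H1 Omega).

Local Notation leb := (lebesgue_rV R d).

Lemma L2_inner_vecC F G : L2_inner_vec Omega F G = L2_inner_vec Omega G F.
Proof.
by apply: eq_Rintegral => x _; apply: eq_bigr => i _; rewrite mulrC.
Qed.

Lemma L2_inner_vec_ge0 F : 0 <= L2_inner_vec Omega F F.
Proof.
by apply: Rintegral_ge0 => x _; apply: sumr_ge0 => i _; rewrite -expr2 sqr_ge0.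
Qed.

Lemma L2_norm_vec_sqr F : L2_norm_vec Omega F ^+ 2 = L2_inner_vec Omega F F.
Proof. exact/sqr_sqrtr/L2_inner_vec_ge0. Qed.

Let dot F G x : R := \sum_i (F i \_ Omega) x * (G i \_ Omega) x.

Let L2_inner_vecE F G : L2_inner_vec Omega F G = \int[leb]_x dot F G x.
Proof.
rewrite /L2_inner_vec Rintegral_mkcond; apply: eq_Rintegral => x _.
rewrite /dot /patch; case: ifP => // _.
by rewrite big1// => i _; rewrite mul0r.
Qed.

Let integrable_dot F G :
  (forall i, in_L2 Omega (F i)) -> (forall i, in_L2 Omega (G i)) ->
  leb.-integrable setT (EFin \o dot F G).
Proof.
move=> FL GL.
have -> : EFin \o dot F G =
    (fun x => \sum_i ((F i \_ Omega) x * (G i \_ Omega) x)%:E)%E.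
  by apply/funext => x; rewrite /dot /= sumEFin.
apply: integrable_sum => // i _.
by apply/Lfun1_integrable; apply: Lfun2_mul_Lfun1; [exact: FL|exact: GL].
Qed.

Lemma L2_inner_vec_comb a F G K :
  (forall i, in_L2 Omega (F i)) -> (forall i, in_L2 Omega (G i)) ->
  (forall i, in_L2 Omega (K i)) ->
  L2_inner_vec Omega (a *: F + G) K =
  a * L2_inner_vec Omega F K + L2_inner_vec Omega G K.
Proof.
move=> FL GL KL; rewrite !L2_inner_vecE -RintegralZl//; last exact: integrable_dot.
rewrite -RintegralD//; last 2 first.
- exact: (integrableZl measurableT a (integrable_dot FL KL)).
- exact: integrable_dot.
apply: eq_Rintegral => x _; rewrite /dot mulr_sumr -big_split/=.
apply: eq_bigr => i _; rewrite mulrA -mulrDl; congr (_ * _).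
by rewrite !fctE /patch; case: ifP => // _; rewrite mulr0 addr0.
Qed.

Lemma grad_in_L2 u i : in_L2 Omega (grad u i).
Proof. by have /H1_predP[_ + _] := H1_pairP u; apply. Qed.

Definition dirichlet u v : R := L2_inner_vec Omega (grad u) (grad v).

Lemma dirichlet_comb a u v w :
  dirichlet (a *: u + v) w = a * dirichlet u w + dirichlet v w.
Proof.
by rewrite /dirichlet grad_comb L2_inner_vec_comb// => i; exact: grad_in_L2.
Qed.

Lemma dirichletC u v : dirichlet u v = dirichlet v u.
Proof. exact: L2_inner_vecC. Qed.

Lemma dirichlet_ge0 u : 0 <= dirichlet u u.
Proof. exact: L2_inner_vec_ge0. Qed.

End dirichlet_form.

(** * The energy estimate *)

Section energy.
Variables (R : realType) (d : nat) (Omega : set 'rV[R]_d).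

Lemma L2_inner_ge0 (f : 'rV[R]_d -> R) : 0 <= L2_inner Omega f f.
Proof. by apply: Rintegral_ge0 => x _; rewrite -expr2 sqr_ge0. Qed.

Lemma potential_energy_ge0 (f : 'rV[R]_d -> R) : 0 <= potential_energy Omega f.
Proof.
by apply: Rintegral_ge0 => x _; rewrite mulr_ge0 ?invr_ge0 ?sqr_ge0.
Qed.

Lemma sav_energy_G_norm theta eps (u : nat -> H1 Omega) r n :
  sav_energy theta eps u r n =
  eps ^+ 2 * G_norm (@dirichlet R d Omega) theta (u n) (u n.-1)
  + 2 * G_norm (@mul_form R) theta (r n) (r n.-1).
Proof.
by rewrite /sav_energy !L2_norm_vec_sqr /G_norm -!/(dirichlet _ _) /mul_form; field.
Qed.

(** The test function is [u_alpha / khat] rather than [u_alpha] because the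
    nonlinear integral [I] is then literally the one of the scalar equation:
    it cancels without any scaling of an integral of the nonlinearity. *)
Lemma dln_sav_step_dissipative theta eps C0 (Xh : set (H1 Omega)) t u r n :
  0 < C0 -> 0 < avg_step theta t n ->
  Xh ((avg_step theta t n)^-1 *: dln_alpha theta u n) ->
  dln_sav_step theta eps C0 Xh t u r n ->
  eps ^+ 2 * dirichlet (dln_alpha theta u n) (dln_beta theta t u n)
  + 2 * mul_form (dln_alpha theta r n) (dln_beta theta t r n) <= 0.
Proof.
move=> C0_gt0 k_gt0 Xv [/(_ _ Xv)].
rewrite -/(dirichlet _ _) (dirichletC (dln_beta _ _ _ _)).
rewrite (form_scale (@dirichlet_comb R d Omega)).
set q := Num.sqrt _; set k := avg_step theta t n in k_gt0 *.
have q_gt0 : 0 < q by rewrite sqrtr_gt0 ltr_wpDl// potential_energy_ge0.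
rewrite /mul_form; set I := L2_inner Omega (_ \o _) _; set D := dirichlet _ _.
have := L2_inner_ge0 (k^-1 *: dln_alpha theta u n).
move: (L2_inner _ _ _) => S S_ge0.
set ra := dln_alpha theta _ n; set rb := dln_beta theta t _ n.
move=> eq1 eq2.
have IE : I = 2 * q * ra / k.
  apply: (mulfI (_ : (2 * q)^-1 != 0)); first by rewrite invr_eq0 gt_eqF ?mulr_gt0.
  by rewrite -eq2; field; rewrite !gt_eqF.
have -> : eps ^+ 2 * D + 2 * (ra * rb) = - (k * S).
  move: eq1; rewrite IE => eq1.
  have : k * (S + eps ^+ 2 * (k^-1 * D) + rb / q * (2 * q * ra / k)) = 0.
    by rewrite eq1 mulr0.
  have -> : k * (S + eps ^+ 2 * (k^-1 * D) + rb / q * (2 * q * ra / k)) =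
      k * S + (eps ^+ 2 * D + 2 * (ra * rb)) by field; rewrite !gt_eqF.
  by move/eqP; rewrite addrC addr_eq0 => /eqP.
by rewrite oppr_le0 mulr_ge0// ltW.
Qed.

End energy.

Theorem theorem4p2 (R : realType) (d : nat) (Hd : (1 <= d <= 3)%N)
  (Omega : set 'rV[R]_d) (HOmega : domain Omega)
  (Th : seq 'M[R]_(d.+1, d)) (HTh : triangulation Omega Th)
  (h : R) (h_gt0 : 0 < h) (Hh : mesh_size Th = h) (s : nat)
  (theta eps C0 : R) (Htheta : 0 <= theta <= 1) (eps_gt0 : 0 < eps)
  (C0_gt0 : 0 < C0)
  (N : nat) (T : R) (t : nat -> R) (t0 : t 0%N = 0) (tN : t N = T)
  (t_incr : forall n, (n < N)%N -> t n < t n.+1)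
  (u : nat -> H1 Omega) (r : nat -> R)
  (u0 : fe_space Th s (u 0%N)) (u1 : fe_space Th s (u 1%N))
  (u_in : forall n, (1 <= n < N)%N -> fe_space Th s (u n.+1))
  (u_r_scheme : forall n, (1 <= n < N)%N ->
     dln_sav_step theta eps C0 (fe_space Th s) t u r n) :
  forall n, (1 <= n < N)%N ->
    sav_energy theta eps u r n.+1 <= sav_energy theta eps u r n.
Proof.
move=> n nN; have /andP[n_gt0 ltnN] := nN.
have a0 : 0 < time_step t n by rewrite subr_gt0 t_incr.
have b0 : 0 < time_step t n.-1.
  by rewrite subr_gt0 t_incr// (leq_ltn_trans (leq_pred n)).
have uX m : (m <= N)%N -> fe_space Th s (u m).
  by case: m => [//|[//|m]] mN; apply: u_in.
have k_gt0 := avg_step_gt0 Htheta a0 b0.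
have Xa : fe_space Th s ((avg_step theta t n)^-1 *: dln_alpha theta u n).
  apply/fe_space_scale/fe_space_dln_alpha; apply: uX => //.
    exact: ltnW.
  exact: leq_trans (leq_pred n) (ltnW ltnN).
have dis := dln_sav_step_dissipative C0_gt0 k_gt0 Xa (u_r_scheme n nN).
have Gu := dln_G_stability (@dirichlet_comb R d Omega) (@dirichletC R d Omega)
  (@dirichlet_ge0 R d Omega) u Htheta a0 b0.
have Gr := mul_form_G_stability r Htheta a0 b0.
rewrite !sav_energy_G_norm -subr_le0; apply: le_trans dis.
have := ler_wpM2l (sqr_ge0 eps) Gu; lra.
Qed.
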